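(* For all integers $m,n\geq3$, \[4\leq\mathrm{pmd}(P_m\square C_n)\leq5.\] In addition, $\mathrm{pmd}(P_m\square C_n)=4$ if either $n$ is even and $n\geq4(m-1)$, or $n$ is odd and $n>2m$.
   Context: All graphs are finite and simple. $P_m$ is the path on $m$ vertices and $C_n$ the cycle on $n$ vertices. A set $M\subseteq E$ of edges of a graph $\Gamma=(V,E)$ is a matching if its edges are pairwise disjoint. A matching $M$ is positive (in $\Gamma$) if there is a weight function $w\colon V\to\mathbb{R}$ such that for every edge $uv\in E$: $w(u)+w(v)>0$ if and only if $uv\in M$. A positive matching decomposition (pmd) of $\Gamma$ with $p$ parts is an ordered partition $E_1,\ldots,E_p$ of $E$ such that $E_i$ is a positive matching of the graph $(V,E\setminus\bigcup_{j=1}^{i-1}E_j)$ for $i=1,\ldots,p$. $\mathrm{pmd}(\Gamma)$ denotes the smallest $p$ for which $\Gamma$ has a pmd with $p$ parts. The Cartesian product $\Gamma_1\square\Gamma_2$ has vertex set $V(\Gamma_1)\times V(\Gamma_2)$, with $(a_1,a_2)\sim(b_1,b_2)$ if either $a_1=b_1$ and $a_2\sim b_2$, or $a_1\sim b_1$ and $a_2=b_2$. *)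

(* Defs.v *)
From HB Require Import structures.
From mathcomp Require Import all_boot all_order all_algebra.
From mathcomp Require Import boolp reals.

Set Implicit Arguments.
Unset Strict Implicit.
Unset Printing Implicit Defensive.

Import Order.TTheory GRing.Theory Num.Theory.

Record sgraph (V : finType) := SGraph {
  edges : {set {set V}};
  card_edges : forall e, e \in edges -> #|e| = 2
}.

(* Edges [set u; v] for distinct u, v with r u v or r v u: loops are dropped
   and r is symmetrized. *)
Definition rel_edges (V : finType) (r : rel V) : {set {set V}} :=
  [set [set p.1; p.2] | p : V * V & (p.1 != p.2) && r p.1 p.2].

Lemma card_rel_edges (V : finType) (r : rel V) e :
  e \in rel_edges r -> #|e| = 2.
Proof.
by case/imsetP=> -[u v]; rewrite inE /= => /andP[uv _] ->; rewrite cards2 uv.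
Qed.

Definition sgraph_of_rel (V : finType) (r : rel V) : sgraph V :=
  SGraph (@card_rel_edges V r).

Lemma in_edges_of_rel (V : finType) (r : rel V) (u v : V) :
  ([set u; v] \in edges (sgraph_of_rel r)) = (u != v) && (r u v || r v u).
Proof.
apply/imsetP/idP => [[[a b]]|/andP[uv /orP[ruv|rvu]]].
- rewrite inE /= => /andP[ab rab] E.
  have : a \in [set u; v] by rewrite E set21.
  have : b \in [set u; v] by rewrite E set22.
  rewrite !inE => /orP[]/eqP eb /orP[]/eqP ea; subst a b;
    by rewrite ?eqxx // in ab; rewrite ?ab ?rab ?orbT // eq_sym ab ?rab ?orbT.
- by exists (u, v); rewrite // inE /= uv.
- by exists (v, u); rewrite /= ?inE /= 1?eq_sym ?uv // setUC.
Qed.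

Lemma card_del_edges (V : finType) (G : sgraph V) (F : {set {set V}}) e :
  e \in edges G :\: F -> #|e| = 2.
Proof. by case/setDP=> /card_edges. Qed.

Definition del_edges (V : finType) (G : sgraph V) (F : {set {set V}}) :
  sgraph V := SGraph (@card_del_edges V G F).

Definition path_graph (m : nat) : sgraph 'I_m :=
  sgraph_of_rel (fun i j : 'I_m => j == i.+1 :> nat).

(* ordS is the cyclic successor i |-> i.+1 %% n, so this is the cycle C_n only
   for n >= 3. *)
Definition cycle_graph (n : nat) : sgraph 'I_n :=
  sgraph_of_rel (fun i j : 'I_n => j == ordS i).

Definition cart_prod (V1 V2 : finType) (G1 : sgraph V1) (G2 : sgraph V2) :
  sgraph (V1 * V2)%type :=
  sgraph_of_rel (fun a b : V1 * V2 =>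
    (a.1 == b.1) && ([set a.2; b.2] \in edges G2)
    || ([set a.1; b.1] \in edges G1) && (a.2 == b.2)).

Definition matching (V : finType) (G : sgraph V) (M : {set {set V}}) : Prop :=
  M \subset edges G /\ trivIset M.

Definition positive_matching (R : realType) (V : finType) (G : sgraph V)
    (M : {set {set V}}) : Prop :=
  matching G M /\
  exists w : V -> R, forall u v : V, [set u; v] \in edges G ->
    ((0 < w u + w v)%R <-> [set u; v] \in M).

Definition ordered_partition (T : finType) (p : nat) (E : 'I_p -> {set T})
    (A : {set T}) : Prop :=
  [/\ forall i, E i != set0,
      forall i j, i != j -> [disjoint E i & E j] &
      \bigcup_(i < p) E i = A].

Definition is_pmd (R : realType) (V : finType) (G : sgraph V) (p : nat)
    (E : 'I_p -> {set {set V}}) : Prop :=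
  ordered_partition E (edges G) /\
  forall i : 'I_p,
    positive_matching R (del_edges G (\bigcup_(j < p | j < i) E j)) (E i).

Definition has_pmd (R : realType) (V : finType) (G : sgraph V) (p : nat) :
  Prop := exists E : 'I_p -> {set {set V}}, is_pmd R G E.

Lemma positive_matching1 (R : realType) (V : finType) (G : sgraph V) e :
  e \in edges G -> positive_matching R G [set e].
Proof.
move=> eG; split; first split.
- by rewrite sub1set.
- by apply/trivIsetP => A B; rewrite !inE => /eqP-> /eqP->; rewrite eqxx.
exists (fun x => if x \in e then 1 else - 2)%R => u v uvG; rewrite inE.
have -> : ([set u; v] == e) = (u \in e) && (v \in e).
  by rewrite eqEcard (card_edges uvG) (card_edges eG) leqnn andbT subUset !sub1set.
have lt12 : (0 < 1 - 2 :> R)%R = false by rewrite subr_gt0 ltrn1.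
case: (u \in e); case: (v \in e); rewrite /=.
- by split=> // _; rewrite addr_gt0.
- by rewrite lt12.
- by rewrite addrC lt12.
- by rewrite -opprD oppr_gt0 -natrD ltrn0.
Qed.

(* Splitting the edge set into singletons gives a pmd, so the minimum defining
   pmd below exists. *)
Lemma has_pmd_card_edges (R : realType) (V : finType) (G : sgraph V) :
  has_pmd R G #|edges G|.
Proof.
exists (fun i => [set enum_val i]); split; first split.
- by move=> i; apply/set0Pn; exists (enum_val i); rewrite set11.
- by move=> i j ij; rewrite disjoints1 inE (inj_eq enum_val_inj).
- apply/setP=> e; apply/bigcupP/idP => [[i _]|eG].
    by rewrite inE => /eqP->; exact: enum_valP.
  by exists (enum_rank_in eG e); rewrite // enum_rankK_in // set11.
move=> i; apply: positive_matching1; rewrite inE enum_valP andbT.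
apply/bigcupP=> -[j ji]; rewrite inE => /eqP/enum_val_inj ij.
by rewrite ij ltnn in ji.
Qed.

Lemma ex_pmd (R : realType) (V : finType) (G : sgraph V) :
  exists p, `[< has_pmd R G p >].
Proof. by exists #|edges G|; apply/asboolP; exact: has_pmd_card_edges. Qed.

Definition pmd (R : realType) (V : finType) (G : sgraph V) : nat :=
  ex_minn (ex_pmd R G).

(* Main.v *)
Require Import Defs.
From mathcomp Require Import all_boot all_order all_algebra.
From mathcomp Require Import boolp reals zify.


(* A decomposition can be read off integer vertex weights w 0, ..., w (p - 1):
   put an edge uv in the part k that is least with w k u + w k v > 0.  This is a
   pmd as soon as every edge gets a part and no two edges with a common vertex
   get the same one.  On a bipartite region such weights are height functions,
   w on the black and - w on the white vertices, and a part consists of the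
   edges whose black end is the higher one.

   If each black vertex sends its left, right, upper and lower edge to four
   different parts, only the cycles winding around the cylinder are an obstacle.
   - Five parts: the first part breaks every row; the upper and the lower edges
     are the next two parts; the rows left are paths, which need two more.
   - Even n: left/down and up/right are exchanged at the black vertices of one
     diagonal.  Away from the diagonal, winding around along the first or the
     second part would take at least m steps down or up; once these two parts
     are removed, the rest is a union of descending helices.
   - Odd n: the four directions are permuted by (up left)(down right) in a cone
     that opens upwards from the first row.  Its two sides are diagonals of
     opposite slopes; crossing both turns up into down and left into right, as
     needed because the colours of the vertices are exchanged after one turn.

   At least four parts are needed since there is a vertex of degree four. *)

Set Implicit Arguments.
Unset Strict Implicit.
Unset Printing Implicit Defensive.

Import Order.TTheory GRing.Theory Num.Theory.

(** * Bounds on pmd from degrees and from weights *)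

Lemma edge_other (V : finType) (G : sgraph V) e (u : V) :
  e \in edges G -> u \in e -> exists2 v, u != v & e = [set u; v].
Proof.
move=> /card_edges/eqP/cards2P[a [b [ab ->]]]; rewrite !inE => /orP[]/eqP->.
  by exists b.
by exists a; rewrite 1?eq_sym // setUC.
Qed.

Lemma edge_neq (V : finType) (G : sgraph V) (u v : V) :
  [set u; v] \in edges G -> u != v.
Proof. by move=> /card_edges; rewrite cards2; case: eqP. Qed.

Lemma degree_le_pmd (R : realType) (V : finType) (G : sgraph V) (v : V) :
  #|[set e in edges G | v \in e]| <= pmd R G.
Proof.
rewrite /pmd; case: ex_minnP => p /asboolP[E [[_ _ Ecov] Epos]] _.
have inE_part e : e \in edges G -> exists i, e \in E i.
  by rewrite -Ecov => /bigcupP[i _]; exists i.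
have [->|[e0]] := set_0Vmem [set e in edges G | v \in e]; first by rewrite cards0.
rewrite inE => /andP[/inE_part[i0 _] _].
pose f e := odflt i0 [pick i | e \in E i].
have fP e : e \in edges G -> e \in E (f e).
  move=> /inE_part[i ei]; rewrite /f; case: pickP => //= /(_ i).
  by rewrite ei.
rewrite -[p in _ <= p]card_ord -(card_in_imset (f := f)) ?max_card //.
move=> e e'; rewrite !inE => /andP[eG ve] /andP[e'G ve'] ff.
have [[_ /trivIsetP triv] _] := Epos (f e).
apply/eqP/negPn/negP => ne.
have := triv e e' (fP _ eG); rewrite ff => /(_ (fP _ e'G) ne).
by move/disjoint_setI0/setP/(_ v); rewrite !inE ve ve'.
Qed.

Lemma pmd_le_parts (R : realType) (V : finType) (G : sgraph V) p
    (E : 'I_p -> {set {set V}}) :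
  (forall i j, i != j -> [disjoint E i & E j]) ->
  \bigcup_(i < p) E i = edges G ->
  (forall i : 'I_p,
    positive_matching R (del_edges G (\bigcup_(j < p | j < i) E j)) (E i)) ->
  pmd R G <= p.
Proof.
elim: p E => [|p IHp] E Edisj Ecov Epos.
  rewrite /pmd; case: ex_minnP => q _; apply; apply/asboolP.
  by exists E; split=> //; split=> // -[].
have [/existsP[i /eqP Ei0]|] := boolP [exists i, E i == set0]; last first.
  rewrite negb_exists => /forallP Ene.
  rewrite /pmd; case: ex_minnP => q _; apply; apply/asboolP.
  by exists E; split.
apply: leqW; apply: (IHp (fun j => E (lift i j))).
- by move=> j k jk; apply: Edisj; rewrite (inj_eq lift_inj).
- rewrite -Ecov; apply/setP => e; apply/bigcupP/bigcupP => -[j _ ej].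
    by exists (lift i j).
  have [k jk|ji] := unliftP i j; first by exists k; rewrite -?jk.
  by move: ej; rewrite ji Ei0 inE.
- move=> k; have -> : \bigcup_(j < p | j < k) E (lift i j) =
      \bigcup_(j < p.+1 | j < lift i k) E j; last exact: Epos.
  apply/setP => e; apply/bigcupP/bigcupP => -[j jk ej].
    by exists (lift i j) => //=; rewrite /bump; lia.
  have [l jl|ji] := unliftP i j; last by move: ej; rewrite ji Ei0 inE.
  by exists l; rewrite -?jl //; move: jk; rewrite jl /= /bump; lia.
Qed.

Definition first_positive (w : nat -> int) (k : nat) : Prop :=
  (0 < w k)%R /\ forall i, i < k -> (w i <= 0)%R.

Lemma first_positive_inj (w : nat -> int) k l :
  first_positive w k -> first_positive w l -> k = l.
Proof.
move=> [wk ltk] [wl ltl]; case: (ltngtP k l) => // [/ltl|/ltk]; lia.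
Qed.

Lemma pmd_le_weights (R : realType) (V : finType) (G : sgraph V) p
    (w : nat -> V -> int) :
  (forall u v, [set u; v] \in edges G ->
    exists2 k, k < p & first_positive (fun i => w i u + w i v)%R k) ->
  (forall u v v' k, [set u; v] \in edges G -> [set u; v'] \in edges G ->
    first_positive (fun i => w i u + w i v)%R k ->
    first_positive (fun i => w i u + w i v')%R k -> v = v') ->
  pmd R G <= p.
Proof.
move=> wex wuniq.
pose s i (e : {set V}) := (\sum_(x in e) w i x)%R.
pose P k e := (0 < s k e)%R && [forall j : 'I_k, (s j e <= 0)%R].
have sE i u v : u != v -> s i [set u; v] = (w i u + w i v)%R.
  by move=> uv; rewrite /s big_setU1 ?big_set1 // inE.
have PP k u v : [set u; v] \in edges G ->
    reflect (first_positive (fun i => w i u + w i v)%R k) (P k [set u; v]).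
  move=> /edge_neq uv; rewrite /P sE //.
  apply: (iffP andP) => -[gt0 le0]; split=> //.
    by move=> i ik; have /forallP/(_ (Ordinal ik)) := le0; rewrite sE.
  by apply/forallP => i; rewrite sE // le0.
have edgeP e : e \in edges G -> exists u v, e = [set u; v].
  move=> eG; have /eqP/cards2P[a [b [_ ->]]] := card_edges eG.
  by exists a, b.
pose E (i : 'I_p) := [set e in edges G | P i e].
apply: (@pmd_le_parts R V G p E).
- move=> i j; apply: contraR => /pred0Pn[e /=]; rewrite !inE.
  case/andP => /andP[eG Pi] /andP[_ Pj]; have [u [v euv]] := edgeP _ eG.
  subst e; apply/eqP/val_inj.
  by apply: (@first_positive_inj (fun i => w i u + w i v)%R); apply/PP.
- apply/setP => e; apply/bigcupP/idP => [[i _]|eG]; first by rewrite inE => /andP[].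
  have [u [v euv]] := edgeP _ eG; subst e.
  by have [k kp /PP-/(_ eG) Pk] := wex _ _ eG; exists (Ordinal kp); rewrite ?inE ?eG.
move=> i; split; first split.
- apply/subsetP => e; rewrite !inE => /andP[eG Pi]; rewrite eG andbT.
  apply/bigcupP => -[j ji]; rewrite inE eG /= => Pj.
  have [u [v euv]] := edgeP _ eG; subst e.
  have /PP-/(_ eG) Fi := Pi; have /PP-/(_ eG) Fj := Pj.
  by move: ji; rewrite (first_positive_inj Fi Fj) ltnn.
- apply/trivIsetP => e f; rewrite !inE => /andP[eG Pe] /andP[fG Pf].
  apply: contraR => /pred0Pn[u /= /andP[ue uf]].
  have [v _ eE] := edge_other eG ue; have [v' _ fE] := edge_other fG uf.
  subst e f; apply/eqP; congr [set u; _].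
  by apply: (wuniq u _ _ i); rewrite ?eG ?fG //; apply/PP.
exists (fun u => (w i u)%:~R)%R => u v; rewrite !inE => /andP[nE eG].
rewrite eG /= -intrD ltr0z; split=> [wi|/PP-/(_ eG)[]//].
apply/PP => //; split=> // j ji.
(* The part [k] of an edge still present is not below [i], or the edge would have been removed. *)
have [k kp Fk] := wex _ _ eG.
have [lek|] := ltnP j k; first by case: Fk => _ ->.
move=> kj; have ki : k < i by exact: leq_ltn_trans ji.
case/negP: nE; apply/bigcupP; exists (Ordinal kp) => //.
by rewrite inE eG; apply/PP.
Qed.

(** * Weights on the cylinder *)

Section Cylinder.
Variables (m n : nat) (n_gt1 : 1 < n).

Let G := cart_prod (path_graph m) (cycle_graph n).

Definition around (u v : 'I_m * 'I_n) := (v.1 == u.1) && (v.2 == ordS u.2).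
Definition along (u v : 'I_m * 'I_n) :=
  (v.1 == u.1.+1 :> nat) && (v.2 == u.2).

Lemma ordS_neq (i : 'I_n) : i != ordS i.
Proof.
apply/eqP => /(congr1 val) /=.
have := ltn_ord i; rewrite -[i < n]/(i.+1 <= n) leq_eqVlt => /orP[/eqP i1|i1].
  by rewrite i1 modnn; lia.
by rewrite modn_small //; lia.
Qed.

Lemma edge_cylinder (u v : 'I_m * 'I_n) :
  ([set u; v] \in edges G) =
  [|| around u v, around v u, along u v | along v u].
Proof.
case: u v => [i j] [k l].
rewrite in_edges_of_rel /around /along /= !in_edges_of_rel.
rewrite xpair_eqE (eq_sym i k) (eq_sym j l).
have [->|_] := eqVneq k i; have [->|_] := eqVneq l j; rewrite ?eqxx //=.
all: rewrite ?andbT ?andbF ?orbF /=.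
- by rewrite (negPf (ordS_neq j)) eqn_leq ltnn andbF.
- by case: (l == _); case: (j == _).
- by case: (_ == i.+1); case: (_ == k.+1).
- by [].
Qed.

(* [W k x y], [cH x y] and [cV x y] are the k-th weight of the vertex in row y
   and column x, the part of the edge from it to the next column, and the part
   of the edge from it to the next row. *)
Lemma pmd_cylinder_le (R : realType) p (W : nat -> nat -> nat -> int)
    (cH cV : nat -> nat -> nat) :
  (forall x y, x < n -> y < m -> cH x y < p /\
    first_positive (fun k => W k x y + W k (x.+1 %% n)%N y)%R (cH x y)) ->
  (forall x y, x < n -> y.+1 < m -> cV x y < p /\
    first_positive (fun k => W k x y + W k x y.+1)%R (cV x y)) ->
  (forall x y, x < n -> y < m -> cH x y <> cH (x.+1 %% n) y) ->
  (forall x y, x < n -> y.+2 < m -> cV x y <> cV x y.+1) ->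
  (forall x y, x < n -> y.+1 < m ->
    [/\ cV x y <> cH x y, cV x y <> cH x y.+1, cV (x.+1 %% n) y <> cH x y &
        cV (x.+1 %% n) y <> cH x y.+1]) ->
  pmd R G <= p.
Proof.
move=> HH HV PH PV PHV.
pose w k (u : 'I_m * 'I_n) := W k u.2 u.1.
have fC k u v : first_positive (fun i => w i u + w i v)%R k ->
    first_positive (fun i => w i v + w i u)%R k.
  rewrite /first_positive addrC => -[? le]; split=> // i.
  by rewrite addrC; exact: le.
have fA u v : around u v ->
    first_positive (fun i => w i u + w i v)%R (cH u.2 u.1).
  case: u v => [i j] [k l] /andP[/= /eqP-> /eqP->].
  by case: (HH j i (ltn_ord j) (ltn_ord i)).
have fL u v : along u v ->
    first_positive (fun i => w i u + w i v)%R (cV u.2 u.1).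
  case: u v => [i j] [k l] /andP[/= /eqP ki /eqP->].
  by rewrite /w /= ki; case: (HV j i (ltn_ord j)) => //; rewrite -ki.
apply: (@pmd_le_weights R _ G p w) => [u v|u v v' k].
- rewrite edge_cylinder => /or4P[] e.
  + by exists (cH u.2 u.1); [case: (HH u.2 u.1)|exact: fA].
  + by exists (cH v.2 v.1); [case: (HH v.2 v.1)|apply/fC/fA].
  + exists (cV u.2 u.1); last exact: fL.
    by case/andP: e => /eqP e _; case: (HV u.2 u.1) => //; rewrite -e.
  + exists (cV v.2 v.1); last exact/fC/fL.
    by case/andP: e => /eqP e _; case: (HV v.2 v.1) => //; rewrite -e.
have inc t l : [set u; t] \in edges G ->
    first_positive (fun i => w i u + w i t)%R l ->
    [\/ around u t /\ l = cH u.2 u.1, around t u /\ l = cH t.2 t.1,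
        along u t /\ l = cV u.2 u.1 | along t u /\ l = cV t.2 t.1].
  rewrite edge_cylinder => /or4P[] e fl;
    [apply: Or41|apply: Or42|apply: Or43|apply: Or44]; split=> //;
    apply: (first_positive_inj fl);
    [exact: fA|exact/fC/fA|exact: fL|exact/fC/fL].
move=> uv uv' k1 k2.
case: (inc _ _ uv k1) => -[]; case: (inc _ _ uv' k2) => -[] {uv uv' k1 k2};
  case: u v v' {inc} => [i j] [i1 j1] [i2 j2] /=;
  move=> /andP[/= /eqP e1 /eqP e2] -> /andP[/= /eqP e3 /eqP e4]; try subst;
  first [by move=> _; congr pair;
            first [exact: ordS_inj | apply: val_inj => /=; lia]
        |move=> E; exfalso; move: E; try have := ltn_ord i;
         try have := ltn_ord i1; try have := ltn_ord i2;
         rewrite /= ?e1 ?e3 /= ?e1 ?e3;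
         match goal with
         | |- context [cH ?x ?y = cH ?z _] =>
             have := @PH x y; have := @PH z y
         | |- context [cV ?x ?y = cV _ ?z] => have := @PV x y; have := @PV x z
         | |- context [cV ?x ?y = cH ?z _] =>
             have := @PHV x y; have := @PHV z y
         | |- context [cH ?z _ = cV ?x ?y] =>
             have := @PHV x y; have := @PHV z y
         end; rewrite !ltn_ord /=; clear; intuition;
         repeat match goal with h : and4 _ _ _ _ |- _ => case: h => * end;
         congruence].
Qed.
End Cylinder.

(* In the coordinate t = x + y mod n the step (x, y) -> (x, y + 1) becomes
   (t, y) -> (t + 1, y + 1). *)
Lemma pmd_sheared_le (R : realType) m n p (W : nat -> nat -> nat -> int)
    (cH cV : nat -> nat -> nat) :
  1 < n ->
  (forall t y, t < n -> y < m -> cH t y < p /\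
    first_positive (fun k => W k t y + W k (t.+1 %% n)%N y)%R (cH t y)) ->
  (forall t y, t < n -> y.+1 < m -> cV t y < p /\
    first_positive (fun k => W k t y + W k (t.+1 %% n)%N y.+1)%R (cV t y)) ->
  (forall t y, t < n -> y < m -> cH t y <> cH (t.+1 %% n) y) ->
  (forall t y, t < n -> y.+2 < m -> cV t y <> cV (t.+1 %% n) y.+1) ->
  (forall t y, t < n -> y.+1 < m ->
    [/\ cV t y <> cH t y, cV t y <> cH t y.+1, cV (t.+1 %% n) y <> cH t y &
        cV t y <> cH (t.+1 %% n) y.+1]) ->
  pmd R (cart_prod (path_graph m) (cycle_graph n)) <= p.
Proof.
move=> n_gt1 HH HV PH PV PHV; have n_gt0 := ltnW n_gt1.
have tn x y : (x + y) %% n < n by rewrite ltn_mod.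
have shiftx x y : (x.+1 %% n + y) %% n = ((x + y) %% n).+1 %% n.
  by rewrite modnDml -[_.+1 in RHS]addn1 modnDml addn1 addSn.
have shifty x y : (x + y.+1) %% n = ((x + y) %% n).+1 %% n.
  by rewrite -[_.+1 in RHS]addn1 modnDml addn1 addnS.
apply: (@pmd_cylinder_le m n n_gt1 R p (fun k x y => W k ((x + y) %% n) y)
  (fun x y => cH ((x + y) %% n) y) (fun x y => cV ((x + y) %% n) y))
  => x y xn ym.
- by rewrite shiftx; exact: HH.
- by rewrite shifty; exact: HV.
- by rewrite shiftx; exact: PH.
- by rewrite shifty; exact: PV.
rewrite !shiftx !shifty; case: (PHV _ _ (tn x y) ym) => h1 h2 h3 h4.
split=> //.
(* The last inequality is the second one of [PHV] at [t + 1]. *)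
by have := ltn_pmod ((x + y) %% n).+1 n_gt0 => /PHV-/(_ y ym)[].
Qed.

Lemma modn_succ t n : t < n -> t.+1 %% n = if t.+1 == n then 0 else t.+1.
Proof.
by case: eqP => [<-|/eqP tn ltn]; [rewrite modnn|rewrite modn_small; lia].
Qed.

Ltac split_ifs := try lia; repeat match goal with
  | |- context [if ?b then _ else _] =>
    lazymatch b with
    | context [if _ then _ else _] => fail
    | _ => case: (boolP b) => ? //=; try lia
    end
  end.

(** * Five parts *)

Section Five.
Variables (m n : nat).

(** Consecutive values sum to 1 and -3 in turn, which selects every other edge of a path. *)
Definition zigzag (p : nat) : int :=
  if odd p then (p.*2%:Z - 1)%R else (- p.*2%:Z)%R.

(* The black vertices are those with x + y even; they are the ones that meet
   across the gap between column n - 1 and column 0 when n is odd and y even. *)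
Definition W5 k x y : int :=
  match k with
  | 0 => if x == 0 then (-1)%R
         else if x == (if odd y then 1 else n.-1) then 2%R else (-10)%R
  | 1 => if odd (x + y) then (y.*2%:Z - 1 - (4 * m)%:Z)%R
         else ((4 * m)%:Z - y.*2%:Z)%R
  | 2 => if odd (x + y) then (- y.*2%:Z - 1 - (4 * m)%:Z)%R
         else ((4 * m)%:Z + y.*2%:Z)%R
  | 3 => zigzag (if odd y then if x == 0 then n.-1 else x.-1 else x)
  | _ => 1%R
  end.

(** The breaks alternate between the two sides of column 0, so a weight 2 has -10 above and below
    it. *)
Definition H5 x y :=
  if odd y then if x == 0 then 0 else if odd x then 3 else 4
  else if x == n.-1 then 0 else if odd x then 4 else 3.

Definition V5 x y := if odd (x + y) then 2 else 1.

Lemma pmd_le5 (R : realType) : 2 < n -> 2 < m ->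
  pmd R (cart_prod (path_graph m) (cycle_graph n)) <= 5.
Proof.
move=> n3 m3; apply: (@pmd_cylinder_le m n (ltnW n3) R 5 W5 H5 V5) => x y xn ym;
  rewrite ?modn_succ //.
- rewrite /H5; split_ifs; (split=> //; split=> [|[|[|[|[|i]]]] //= _]);
    rewrite /W5 /zigzag; split_ifs.
- rewrite /V5; split_ifs; (split=> //; split=> [|[|[|[|[|i]]]] //= _]);
    rewrite /W5 /zigzag; split_ifs.
- rewrite /H5; split_ifs.
- rewrite /V5; split_ifs.
- rewrite /H5 /V5; split; split_ifs.
Qed.
End Five.

(** * Four parts for odd n *)

Section Odd.
Variables (m n : nat).

(* The black vertices are those with t even.  The cone is t <= 2 y, and two
   black vertices meet between columns n - 1 and 0. *)
Definition Wodd k t y : int :=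
  match k with
  | 0 => if odd t then
           if t < y.*2 then (y.*2%:Z - t.*2%:Z - 1)%R
           else (y.*2%:Z - (4 * m)%:Z - 5)%R
         else if t == n.-1 then (y.*2%:Z + 1)%R
         else if t <= y.*2 then (t.*2%:Z - y.*2%:Z)%R
         else ((4 * m)%:Z + 4 - y.*2%:Z)%R
  | 1 => if odd t then
           if t <= y.*2.+1 then (t.*2%:Z - y.*2%:Z - 1)%R
           else ((4 * m)%:Z - y.*2%:Z - 1)%R
         else if t <= y.*2 then (y.*2%:Z - t.*2%:Z)%R
         else (y.*2%:Z - (4 * m)%:Z)%R
  | 2 => if odd t then
           if t < y.*2 then (- y.*2%:Z - 1 - n.*2%:Z)%R
           else (t.*2%:Z - 1)%R
         else if t <= y.*2 then (y.*2%:Z + n.*2%:Z)%R else (- t.*2%:Z)%R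
  | _ => 1%R
  end.

(** At black vertices up, down, right, left get 0, 1, 2, 3 outside the cone and 3, 2, 1, 0 inside;
    the edges from [t = n.-1] to [t = 0] are labelled as seen from [t = 0]. *)
Definition Hodd t y :=
  if t == n.-1 then 0
  else if odd t then if t < y.*2 then 0 else 3
  else if t <= y.*2 then 1 else 2.

Definition Vodd t y :=
  if t == n.-1 then 2
  else if odd t then if t <= y.*2.+1 then 2 else 1
  else if t <= y.*2 then 3 else 0.

Lemma pmd_odd_le4 (R : realType) : 2 < m -> odd n -> 2 * m < n ->
  pmd R (cart_prod (path_graph m) (cycle_graph n)) <= 4.
Proof.
move=> m3 on nm; have n3 : 2 < n by lia.
(* By [2 * m < n] the cone ends before column [n.-1]. *)
apply: (@pmd_sheared_le R m n 4 Wodd Hodd Vodd (ltnW n3)) => t y tn ym;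
  rewrite ?modn_succ //.
- rewrite /Hodd; split_ifs; (split=> //; split=> [|[|[|[|i]]] //= _]);
    rewrite /Wodd; split_ifs.
- rewrite /Vodd; split_ifs; (split=> //; split=> [|[|[|[|i]]] //= _]);
    rewrite /Wodd; split_ifs.
- rewrite /Hodd; split_ifs.
- rewrite /Vodd; split_ifs.
- rewrite /Hodd /Vodd; split; split_ifs.
Qed.
End Odd.

(** * Four parts for even n *)

Section Even.
Variables (m n : nat).

(* The diagonal is t = 0.  As 12 > 2 * 5, the height 12 y - 5 t decreases along
   the steps down/left of the first part; by n >= 4 (m - 1) it is below the
   heights - 2 y on the diagonal when t reaches n. *)
Definition Deven (t y : nat) : int :=
  if odd t then if t == n.-1 then (y.*2%:Z + 1)%R
                else ((5 * t)%:Z - (12 * y)%:Z - 6)%R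
  else if t == 0 then (- y.*2%:Z)%R else ((12 * y)%:Z - (5 * t)%:Z)%R.

(* The second part is the first one rotated by a half turn; n y + t is the
   height along the helices. *)
Definition Weven k t y : int :=
  match k with
  | 0 => Deven t y
  | 1 => Deven (if t == 0 then 0 else n - t) (m.-1 - y)
  | 2 => if odd t then (- (n * y + t)%N%:Z)%R else (n * y + t)%N%:Z%R
  | _ => 1%R
  end.

(** At black vertices, [t] even, down, up, left, right get 0, 1, 2, 3, and 2, 3, 0, 1 on the
    diagonal. *)
Definition Heven t (y : nat) :=
  if odd t then if t == n.-1 then 0 else 2 else if t == 0 then 1 else 3.

Definition Veven t (y : nat) :=
  if odd t then if t == n.-1 then 2 else 0 else if t == 0 then 3 else 1.

Lemma pmd_even_le4 (R : realType) : 2 < m -> ~~ odd n -> 4 * (m - 1) <= n ->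
  pmd R (cart_prod (path_graph m) (cycle_graph n)) <= 4.
Proof.
move=> m3 on nm; have n3 : 2 < n by lia.
apply: (@pmd_sheared_le R m n 4 Weven Heven Veven (ltnW n3)) => t y tn ym;
  rewrite ?modn_succ //.
- rewrite /Heven; split_ifs; (split=> //; split=> [|[|[|[|i]]] //= _]);
    rewrite /Weven /Deven; split_ifs.
- rewrite /Veven; split_ifs; (split=> //; split=> [|[|[|[|i]]] //= _]);
    rewrite /Weven /Deven ?mulnS; split_ifs.
- rewrite /Heven; split_ifs.
- rewrite /Veven; split_ifs.
- rewrite /Heven /Veven; split; split_ifs.
Qed.
End Even.

(** * Lower bound and conclusion *)

Lemma pmd_cylinder_ge4 (R : realType) m n : 2 < m -> 2 < n ->
  4 <= pmd R (cart_prod (path_graph m) (cycle_graph n)).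
Proof.
move=> m3 n3.
pose r k (km : k < 3) : 'I_m := Ordinal (leq_trans km m3).
pose c k (kn : k < 3) : 'I_n := Ordinal (leq_trans kn n3).
pose u := (r 1 isT, c 1 isT).
pose s := [set (r 1 isT, c 0 isT); (r 1 isT, c 2 isT); (r 0 isT, c 1 isT);
               (r 2 isT, c 1 isT)].
apply: leq_trans (degree_le_pmd R _ u).
have cs : #|s| = 4.
  by rewrite /s -!setUA !cardsU1 cards1 !inE !xpair_eqE.
rewrite -cs.
rewrite -(card_in_imset (f := fun v => [set u; v])); last first.
  move=> v v' vs v's E.
  have vu w : w \in s -> w != u.
    by rewrite !inE -!orbA => /or4P[]/eqP->.
  have : v \in [set u; v'] by rewrite -E set22.
  by rewrite !inE (negPf (vu _ vs)) => /eqP.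
apply/subset_leq_card/subsetP => _ /imsetP[v vs ->].
rewrite inE set21 andbT edge_cylinder ?(ltnW n3) // /around /along.
move: vs; rewrite !inE -!orbA => /or4P[]/eqP->;
  by rewrite -!(inj_eq val_inj) /= ?(modn_small n3) ?(modn_small (ltnW n3))
    ?eqxx.
Qed.

Theorem proposition4p1 (R : realType) (m n : nat) (hm : 3 <= m) (hn : 3 <= n) :
  4 <= pmd R (cart_prod (path_graph m) (cycle_graph n)) <= 5 /\
  ((~~ odd n /\ 4 * (m - 1) <= n) \/ (odd n /\ 2 * m < n) ->
   pmd R (cart_prod (path_graph m) (cycle_graph n)) = 4).
Proof.
have ge4 := pmd_cylinder_ge4 R hm hn.
split=> [|par]; first by rewrite ge4 pmd_le5.
apply/eqP; rewrite eqn_leq ge4 andbT.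
by case: par => -[parity_n le_n]; [exact: pmd_even_le4|exact: pmd_odd_le4].
Qed.
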